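(* Let $p$ be a prime with $p \equiv 3 \pmod{4}$. Then for all integers $\alpha \geq 0$ and $n \geq 0$, and for every integer $i$ with $1 \leq i \leq p-1$, $$\mathrm{RD}^{(4,9)}\left(12p^{2\alpha+1}(pn+i) + p^{2\alpha+2} + 1\right) \equiv 0 \pmod{4}.$$
   Context: For a nonnegative integer $n$, $\mathrm{RD}^{(4,9)}(n)$ denotes the number of partitions of $n$ into parts that are simultaneously 4-regular and 9-distinct, i.e., partitions of $n$ in which no part is divisible by $4$ and each distinct part appears at least once and at most $8$ times. Equivalently, writing $f_k = \prod_{m\ge1}(1-q^{km})$, $\sum_{n\ge0}\mathrm{RD}^{(4,9)}(n)q^n = \frac{f_9 f_4}{f_1 f_{36}}$. *)

(* Defs.v *)
From mathcomp Require Import all_boot.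

Set Implicit Arguments.
Unset Strict Implicit.
Unset Printing Implicit Defensive.

Definition is_partition (n : nat) (s : seq nat) : bool :=
  [&& sorted geq s, all (leq 1) s & sumn s == n].

Definition regular (l : nat) (s : seq nat) : bool :=
  all (fun k => ~~ (l %| k)) s.

(* As usual for [t]-distinct partitions, a part may be repeated, but fewer
   than [t] times. *)
Definition distinct (t : nat) (s : seq nat) : bool :=
  all (fun k => count_mem k s < t) s.

(* A partition of [n] has at most [n] parts, each at most [n], so it is given by
   exactly one element of the finite type [n.-bseq 'I_n.+1]: see
   [is_partition_bseq]. *)
Definition RD (l t n : nat) : nat :=
  #|[set u : n.-bseq 'I_n.+1 |
      let s := [seq val k | k <- u] in
      [&& is_partition n s, regular l s & distinct t s]]|.

Lemma is_partition_bseq (n : nat) (s : seq nat) :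
  is_partition n s ->
  exists! u : n.-bseq 'I_n.+1, [seq val k | k <- u] = s.
Proof.
case/and3P=> _ s_gt0 /eqP sum_s.
have size_s : size s <= n.
  rewrite -sum_s; elim: s s_gt0 {sum_s} => //= k s IHs /andP[k_gt0 /IHs].
  by rewrite -add1n; apply: leq_add.
have le_s : all (fun k => k < n.+1) s.
  apply/allP=> k s_k; rewrite ltnS -sum_s.
  elim: s s_k {s_gt0 sum_s size_s} => //= j s IHs.
  rewrite inE => /orP[/eqP-> | /IHs le_k]; first exact: leq_addr.
  exact: leq_trans le_k (leq_addl _ _).
have inordK_s : [seq val k | k <- [seq inord k : 'I_n.+1 | k <- s]] = s.
  rewrite -map_comp -[RHS]map_id; apply/eq_in_map=> k s_k /=.
  by rewrite inordK // (allP le_s).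
have size_u : size [seq inord k : 'I_n.+1 | k <- s] <= n by rewrite size_map.
exists (Bseq size_u); split=> // v def_s.
by apply/val_inj/(inj_map val_inj); rewrite /= inordK_s.
Qed.

(* Main.v *)
Require Import Defs.
From mathcomp Require Import all_boot.
From mathcomp Require Import all_algebra.
From mathcomp Require Import zify ring.

(** Let G be the generating function of RD^(4,9), phi(q) = f_1^2 / f_2 and
    psi(q) = f_1 f_4 / f_2, so that G phi(q) psi(q^9) = psi(q) phi(q^9). By the
    Jacobi triple product phi(q) = 1 + 2 S modulo 4, where S is the sum of the
    q^(k^2) for k > 0, and psi(q) = B - q psi(q^9), where all the exponents in B
    are multiples of 3. As phi(q)^2 = 1 modulo 4, this gives
      G psi(q^9) = (B - q psi(q^9)) (1 + 2 T)    modulo 4,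
    where T is the part of S with k prime to 3, whose exponents are 1 modulo 3.
    Moreover T B = q psi(q^9) modulo 2, so that
      (G - q + 2 q T) psi(q^9) = B               modulo 4.
    Dividing by psi(q^9), a series in q^3, one reads off the coefficients of G
    at the exponents n prime to 3: modulo 4 the one at n = 1 modulo 3 vanishes
    unless n = 1, and the one at n = 2 modulo 3 vanishes unless n - 1 is a square.
    The first case is the one of p = 3; for the other p, the exponent of p
    in n - 1 is odd. *)

Set Implicit Arguments.
Unset Strict Implicit.
Unset Printing Implicit Defensive.

Import GRing.Theory.

Local Open Scope ring_scope.

(** * Gaussian binomial coefficients and the q-binomial theorem *)

Fixpoint qbin (A : comNzRingType) (Q : A) (M j : nat) : A :=
  match M, j with
  | _, 0 => 1
  | 0, _.+1 => 0
  | M'.+1, j'.+1 => Q ^+ j * qbin Q M' j + qbin Q M' j'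
  end.

Lemma qbin0 (A : comNzRingType) (Q : A) (M : nat) : qbin Q M 0 = 1.
Proof. by case: M. Qed.

Lemma qbin_gt (A : comNzRingType) (Q : A) (M j : nat) :
  (M < j)%N -> qbin Q M j = 0.
Proof.
elim: M j => [|M IHM] [|j] //= lt_Mj.
by rewrite !IHM ?mulr0 ?addr0 // ltnW.
Qed.

(** Peeling off the factor [i = 0] leaves the same product with [x * Q] for [x], whence an induction
    over all [x]; the recurrence of [qbin] recombines the terms. *)
Lemma qbinomial (A : comNzRingType) (Q x y : A) (M : nat) :
  \prod_(i < M) (y + x * Q ^+ i) =
  \sum_(j < M.+1) qbin Q M j * Q ^+ 'C(j, 2) * x ^+ j * y ^+ (M - j).
Proof.
elim: M x => [|M IHM] x; first by rewrite big_ord0 big_ord1 /=; ring.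
rewrite big_ord_recl /= expr0 mulr1.
under eq_bigr => i _ do rewrite /bump /= add1n exprS mulrA.
rewrite IHM [RHS]big_ord_recl /= mulrDl addrC.
under [X in _ = _ + X]eq_bigr => j _ do
  rewrite /bump /= add1n !mulrDl subSS binS bin1 addnC.
rewrite big_split /= addrA [LHS]addrC; congr (_ + _); last first.
  rewrite mulr_sumr; apply: eq_bigr => j _.
  by rewrite exprMn exprS exprD; ring.
rewrite [in RHS]big_ord_recr /= qbin_gt // mulr0 !mul0r addr0.
rewrite big_ord_recl /= mulrDr; congr (_ + _).
  by rewrite qbin0 !subn0 exprS; ring.
rewrite mulr_sumr; apply: eq_bigr => j _.
rewrite /bump /= add1n binS bin1 addnC exprMn.
have -> : (M - j = (M - j.+1).+1)%N by have := ltn_ord j; lia.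
by rewrite (exprS y); ring.
Qed.

Lemma qbin_step (A : comNzRingType) (Q : A) (M j : nat) : (j <= M)%N ->
  qbin Q M j.+1 * (1 - Q ^+ j.+1) = qbin Q M j * (1 - Q ^+ (M - j)).
Proof.
elim: M j => [|M IHM] j le_jM.
  by move: le_jM; rewrite leqn0 => /eqP->; rewrite /= expr0; ring.
(* The absorption identity brings the left side down to [qbin Q M j]; the right side is then
   expanded by the recurrence. *)
have -> : qbin Q M.+1 j.+1 * (1 - Q ^+ j.+1) = qbin Q M j * (1 - Q ^+ M.+1).
  rewrite /=; have [le_jM'|lt_Mj] := leqP j M; last first.
    by rewrite !qbin_gt ?mulr0 ?addr0 ?mul0r // ltnW.
  have -> : M.+1 = (j.+1 + (M - j))%N by lia.
  by rewrite mulrDl -mulrA IHM // exprD; ring.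
case: j le_jM => [|j] le_jM /=; first by rewrite qbin0 subn0.
have -> : M.+1 = (j.+1 + (M - j))%N by lia.
by rewrite subSS addKn mulrDl -(IHM j) // exprD; ring.
Qed.

Lemma qbin_fact (A : comNzRingType) (Q : A) (M r : nat) : (r <= M)%N ->
  qbin Q M r * \prod_(i < r) (1 - Q ^+ i.+1) = \prod_(i < r) (1 - Q ^+ (M - i)).
Proof.
elim: r => [|r IHr] le_rM; first by rewrite !big_ord0 qbin0 mulr1.
rewrite !big_ord_recr /= -IHr 1?ltnW // [RHS]mulrAC -qbin_step 1?ltnW //.
by ring.
Qed.

(** This stands in for the symmetry of Gaussian binomials: [qbin_step] is used downwards, starting
    from [qbin Q M M = 1]. *)
Lemma qbin_fact_sub (A : comNzRingType) (Q : A) (M r : nat) : (r <= M)%N ->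
  qbin Q M (M - r) * \prod_(i < r) (1 - Q ^+ i.+1) =
  \prod_(i < r) (1 - Q ^+ (M - i)).
Proof.
elim: r => [|r IHr] le_rM.
  rewrite !big_ord0 mulr1 subn0; elim: M {le_rM} => //= M ->.
  by rewrite qbin_gt // mulr0 add0r.
rewrite !big_ord_recr /= -IHr 1?ltnW //.
have -> : (M - r = (M - r.+1).+1)%N by lia.
rewrite [RHS]mulrAC qbin_step ?leq_subr //.
have -> : (M - (M - r.+1) = r.+1)%N by lia.
by ring.
Qed.

(** * Power series as polynomials modulo ['X^N] *)

Definition eqX (R : comNzRingType) (N : nat) (p r : {poly R}) : Prop :=
  forall i, (i < N)%N -> p`_i = r`_i.

Lemma eqX_refl (R : comNzRingType) N (p : {poly R}) : eqX N p p.
Proof. by []. Qed.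

Lemma eqX_sym (R : comNzRingType) N (p r : {poly R}) : eqX N p r -> eqX N r p.
Proof. by move=> pr i ltiN; rewrite pr. Qed.

Lemma eqX_trans (R : comNzRingType) N (r p s : {poly R}) :
  eqX N p r -> eqX N r s -> eqX N p s.
Proof. by move=> pr rs i ltiN; rewrite pr ?rs. Qed.

Lemma eqX_le (R : comNzRingType) N M (p r : {poly R}) :
  (M <= N)%N -> eqX N p r -> eqX M p r.
Proof. by move=> leMN pr i ltiM; apply/pr/(leq_trans ltiM). Qed.

Lemma eqXD (R : comNzRingType) N (p p' r r' : {poly R}) :
  eqX N p p' -> eqX N r r' -> eqX N (p + r) (p' + r').
Proof. by move=> pp rr i ltiN; rewrite !coefD pp ?rr. Qed.

Lemma eqXB (R : comNzRingType) N (p p' r r' : {poly R}) :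
  eqX N p p' -> eqX N r r' -> eqX N (p - r) (p' - r').
Proof. by move=> pp rr i ltiN; rewrite !coefB pp ?rr. Qed.

Lemma eqXM (R : comNzRingType) N (p p' r r' : {poly R}) :
  eqX N p p' -> eqX N r r' -> eqX N (p * r) (p' * r').
Proof.
move=> pp rr i ltiN; rewrite !coefM; apply: eq_bigr => j _.
rewrite pp ?rr //; first exact: leq_ltn_trans (leq_subr _ _) ltiN.
by apply: leq_ltn_trans ltiN; rewrite -ltnS.
Qed.

Lemma eqXMl (R : comNzRingType) N (s p r : {poly R}) :
  eqX N p r -> eqX N (s * p) (s * r).
Proof. exact: eqXM (eqX_refl _). Qed.

Lemma eqXMr (R : comNzRingType) N (s p r : {poly R}) :
  eqX N p r -> eqX N (p * s) (r * s).
Proof. by move/eqXM; apply. Qed.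

Lemma eqX_sum (R : comNzRingType) N n (F G : nat -> {poly R}) :
  (forall i, (i < n)%N -> eqX N (F i) (G i)) ->
  eqX N (\sum_(i < n) F i) (\sum_(i < n) G i).
Proof.
move=> FG; apply: (big_ind2 (eqX N)) => // [p p' r r'|i _]; first exact: eqXD.
exact: FG.
Qed.

Lemma eqX_prod1 (R : comNzRingType) N n (F : nat -> {poly R}) :
  (forall i, (i < n)%N -> eqX N (F i) 1) -> eqX N (\prod_(i < n) F i) 1.
Proof.
move=> F1; apply: (big_ind (fun p => eqX N p 1)) => // [p r p1 r1|i _].
  by rewrite -[1]mulr1; apply: eqXM.
exact: F1.
Qed.

Lemma eqX_Xn (R : comNzRingType) N k : (N <= k)%N -> @eqX R N 'X^k 0.
Proof. by move=> leNk i ltiN; rewrite coefXn coef0 ltn_eqF // (leq_trans ltiN). Qed.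

Lemma eqX_1B (R : comNzRingType) N k : (N <= k)%N -> @eqX R N (1 - 'X^k) 1.
Proof. by move/eqX_Xn=> Xk; rewrite -[X in eqX _ _ X]subr0; apply: eqXB. Qed.

(** A factor ['X^k] gains [k] orders of precision, which makes up for coefficients known only to low
    order. *)
Lemma eqXMXn (R : comNzRingType) M N k (p r : {poly R}) :
  (N <= M + k)%N -> eqX M p r -> eqX N (p * 'X^k) (r * 'X^k).
Proof.
move=> leN pr i ltiN; rewrite !coefMXn; case: ltnP => // leki.
by apply: pr; lia.
Qed.

(** * Truncated q-Pochhammer products $(q^a; q^c)_n$ *)

Definition poch (R : comNzRingType) (a c n : nat) : {poly R} :=
  \prod_(m < n) (1 - 'X^(a + c * m)).

Lemma pochE (R : comNzRingType) a c m n : 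
  poch R a c (m + n) = poch R a c m * poch R (a + c * m) c n.
Proof.
rewrite /poch big_split_ord /=; congr (_ * _); apply: eq_bigr => i _.
by rewrite mulnDr addnA.
Qed.

Lemma poch_ge (R : comNzRingType) N a c n : (N <= a)%N -> eqX N (poch R a c n) 1.
Proof.
by move=> leNa; apply: (@eqX_prod1 _ _ _ (fun m => 1 - 'X^(a + c * m))) => i _;
  apply/eqX_1B/(leq_trans leNa)/leq_addr.
Qed.

Lemma poch_stable (R : comNzRingType) N a c m n :
  (N <= a + c * m)%N -> (m <= n)%N -> eqX N (poch R a c n) (poch R a c m).
Proof.
move=> leN /subnKC <-; rewrite pochE -[X in eqX _ _ X]mulr1.
exact/eqXMl/poch_ge.
Qed.

(** * The Jacobi triple product *)

Lemma double_binomial2 k : (2 * 'C(k, 2) + k = k * k)%N.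
Proof. by elim: k => // k IHk; rewrite binS bin1; lia. Qed.

Lemma binomial2D m k : 'C(m + k, 2) = ('C(m, 2) + 'C(k, 2) + m * k)%N.
Proof.
have := double_binomial2 (m + k); have := double_binomial2 m.
by have := double_binomial2 k; lia.
Qed.

(* The q-binomial theorem for the product of the [q^(c * n) - q^(a + c * i)],
   [i < 2 * n], divided by the monomial [(-1)^n 'X^e] that makes the Laurent
   polynomials of the usual statement into polynomials. *)
Lemma finite_jacobi (R : comNzRingType) a b n (Q := 'X^(a + b) : {poly R}) :
  poch R a (a + b) n * poch R b (a + b) n =
  \sum_(k < n.+1) (-1) ^+ k * qbin Q (2 * n) (n - k)
      * 'X^((a + b) * 'C(k, 2) + b * k) +
  \sum_(k < n) (-1) ^+ k.+1 * qbin Q (2 * n) (n + k.+1)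
      * 'X^((a + b) * 'C(k.+1, 2) + a * k.+1).
Proof.
set c := (a + b)%N.
(* The first [n] factors contribute $q^{a+ci}$ each and leave [poch R b c n] up to sign; the last
   [n] contribute $q^{cn}$ each and leave [poch R a c n]. *)
pose e := (\sum_(i < n) (a + c * i) + c * n * n)%N.
have eE : e = (c * 'C(n, 2) + a * n + c * n * n)%N.
  rewrite /e big_split /= sum_nat_const card_ord -big_distrr /=.
  have -> : (\sum_(i < n) i = 'C(n, 2))%N.
    by rewrite -bin2_sum big_mkord.
  by lia.
have := @qbinomial _ Q (- 'X^a) 'X^(c * n) (2 * n).
have -> : \prod_(i < 2 * n) ('X^(c * n) + - 'X^a * Q ^+ i) =
   'X^e * ((-1) ^+ n * (poch R a c n * poch R b c n)) :> {poly R}.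
  rewrite mul2n -addnn big_split_ord /= /e exprD.
  have -> : \prod_(i < n) ('X^(c * n) + - 'X^a * Q ^+ i) =
     (-1) ^+ n * 'X^(\sum_(i < n) (a + c * i)) * poch R b c n :> {poly R}.
    rewrite [poch R b c n](reindex_inj rev_ord_inj) /=.
    rewrite -[in X in (-1) ^+ X](card_ord n) -prodr_const expr_sum.
    rewrite -!big_split /=; apply: eq_bigr => i _.
    have -> : (c * n = a + c * i + (b + c * (n - i.+1)))%N.
      by have := ltn_ord i; rewrite /c; nia.
    by rewrite /Q -/c -exprM !exprD; ring.
  have -> : \prod_(i < n) ('X^(c * n) + - 'X^a * Q ^+ (n + i)) =
     'X^(c * n * n) * poch R a c n :> {poly R}.
    have -> : 'X^(c * n * n) = \prod_(i < n) 'X^(c * n) :> {poly R}.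
      by rewrite exprM prodr_const card_ord.
    rewrite /poch -big_split /=.
    apply: eq_bigr => i _; rewrite /Q -/c -exprM mulnDr !exprD; ring.
  by ring.
move=> jac.
have sgn : (-1) ^+ n * (-1) ^+ n = 1 :> {poly R} by rewrite -expr2 sqrr_sign.
apply: (@monic_lreg _ ('X^e) (monicXn _ _)) => /=.
have -> : 'X^e * (poch R a c n * poch R b c n)
   = (-1) ^+ n * ('X^e * ((-1) ^+ n * (poch R a c n * poch R b c n))).
  transitivity ((-1) ^+ n * (-1) ^+ n * ('X^e * (poch R a c n * poch R b c n))).
    by rewrite sgn mul1r.
  ring.
(* The indices [n - k] of the q-binomial sum give the first sum, the indices [n + k.+1] the
   second. *)
rewrite jac {jac}; have -> : ((2 * n).+1 = n.+1 + n)%N by lia.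
rewrite big_split_ord /= !mulrDr; congr (_ + _).
  rewrite [in LHS](reindex_inj rev_ord_inj) /= !mulr_sumr.
  apply: eq_bigr => k _; have := ltn_ord k; rewrite ltnS subSS.
  move: (nat_of_ord k) => {}k lekn.
  rewrite (exprNn 'X^a) /Q -!exprM.
  set s := (-1) ^+ n in sgn *; set B := qbin _ _ _.
  have -> : (-1) ^+ (n - k) = s * (-1) ^+ k :> {poly R}.
    rewrite /s -[X in (-1) ^+ X * _](subnK lekn) exprD -mulrA -expr2.
    by rewrite sqrr_sign mulr1.
  transitivity (s * s * ((-1) ^+ k * B * ('X^(c * 'C(n - k, 2)) * 'X^(a * (n - k))
      * 'X^(c * n * (2 * n - (n - k)))))); first ring.
  rewrite sgn mul1r [RHS]mulrCA; congr (_ * _); rewrite -!exprD; congr ('X^_).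
  rewrite eE; have := binomial2D (n - k) k; rewrite subnK // => ->.
  have := double_binomial2 k; set d := 'C(k, 2); set f := 'C(n - k, 2).
  have -> : (2 * n - (n - k) = (n - k) + k + k)%N by lia.
  move: (n - k)%N (subnK lekn) => m <- dE.
  have := congr1 (muln c) dE; rewrite /c; nia.
rewrite !mulr_sumr; apply: eq_bigr => k _.
have -> : (n.+1 + k = n + k.+1)%N by lia.
move: (nat_of_ord k).+1 (ltn_ord k) => {}k lekn.
rewrite (exprNn 'X^a) /Q -!exprM (exprD (-1)).
set s := (-1) ^+ n in sgn *; set B := qbin _ _ _.
transitivity (s * s * ((-1) ^+ k * B * ('X^(c * 'C(n + k, 2)) * 'X^(a * (n + k))
    * 'X^(c * n * (2 * n - (n + k)))))); first ring.
rewrite sgn mul1r [RHS]mulrCA; congr (_ * _); rewrite -!exprD; congr ('X^_).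
rewrite eE binomial2D.
have -> : (2 * n - (n + k) = n - k)%N by lia.
move: (n - k)%N (subnK lekn) => m; nia.
Qed.

Lemma eqX_sum0 (R : comNzRingType) N n (F : nat -> {poly R}) :
  (forall i, (i < n)%N -> eqX N (F i) 0) -> eqX N (\sum_(i < n) F i) 0.
Proof. by move/(@eqX_sum _ _ _ _ (fun=> 0)); rewrite big1_eq. Qed.

(** The first [r] factors of [poch R c c n] turn the Gaussian binomial into a product of
    [1 - Q ^+ (2 * n - i)]; these and the remaining factors only involve exponents above [r]. *)
Lemma qbin_limit (R : comNzRingType) c n r (Q := 'X^c : {poly R}) :
    (0 < c)%N -> (r <= n)%N ->
  eqX r.+1 (qbin Q (2 * n) r * poch R c c n) 1 /\
  eqX r.+1 (qbin Q (2 * n) (2 * n - r) * poch R c c n) 1.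
Proof.
move=> c0 lern; have := qbin_fact Q (leq_trans lern (leq_pmull n (isT : 0 < 2)%N)).
have := qbin_fact_sub Q (leq_trans lern (leq_pmull n (isT : 0 < 2)%N)).
have -> : \prod_(i < r) (1 - Q ^+ i.+1) = poch R c c r.
  by apply: eq_bigr => i _; rewrite /Q -exprM mulnS.
have P1 : eqX r.+1 (\prod_(i < r) (1 - Q ^+ (2 * n - i))) 1.
  apply: (@eqX_prod1 _ _ _ (fun i => 1 - Q ^+ (2 * n - i))) => i ltir.
  by rewrite /Q -exprM; apply: eqX_1B; nia.
rewrite -(subnKC lern) pochE !mulrA subnKC // => -> ->.
suff lim : eqX r.+1 (\prod_(i < r) (1 - Q ^+ (2 * n - i))
                     * poch R (c + c * r) c (n - r)) 1 by [].
rewrite -[X in eqX _ _ X]mulr1; apply: eqXM => //; apply: poch_ge; nia.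
Qed.

(* The two terms are those of the indices [k] and [- k - 1] of the bilateral sum. *)
Definition theta (R : comNzRingType) (a b n : nat) : {poly R} :=
  \sum_(k < n) (-1) ^+ k * ('X^((a + b) * 'C(k, 2) + b * k)
                          - 'X^((a + b) * 'C(k.+1, 2) + a * k.+1)).

(** For (a, b) = (1, 1), (1, 3), (9, 9), (9, 27) these are truncations of phi(q), psi(q), phi(q^9),
    psi(q^9). *)
Definition jprod (R : comNzRingType) (a b n : nat) : {poly R} :=
  poch R a (a + b) n * poch R b (a + b) n * poch R (a + b) (a + b) n.

Lemma theta_stable (R : comNzRingType) a b m n :
    (0 < a)%N -> (0 < b)%N -> (m <= n)%N ->
  eqX m (theta R a b n) (theta R a b m).
Proof.
move=> a0 b0 /subnKC <-; rewrite /theta big_split_ord /= -[X in eqX _ _ X]addr0.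
apply: eqXD => //.
apply: (@eqX_sum0 _ _ _ (fun i => (-1) ^+ (m + i)
    * ('X^((a + b) * 'C(m + i, 2) + b * (m + i))
       - 'X^((a + b) * 'C((m + i).+1, 2) + a * (m + i).+1)))) => i _.
rewrite -[X in eqX _ _ X](mulr0 ((-1) ^+ (m + i))) -[X in eqX _ _ (_ * X)]subr0.
by apply/eqXMl/eqXB; apply: eqX_Xn; nia.
Qed.

(** In [finite_jacobi] times the third product, the coefficient of the term of index [k] is a sign
    modulo ['X^(n - k).+1], and the monomial of that term, of degree at least [k], restores the
    precision. *)
Lemma jacobi (R : comNzRingType) a b n :
  (0 < a)%N -> (0 < b)%N -> eqX n (jprod R a b n) (theta R a b n).
Proof.
move=> a0 b0; rewrite /jprod finite_jacobi mulrDl.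
have c0 : (0 < a + b)%N by rewrite addn_gt0 a0.
under eq_bigr => k _ do rewrite mulrC.
have -> : theta R a b n = \sum_(k < n) (-1) ^+ k * 'X^((a + b) * 'C(k, 2) + b * k)
    + \sum_(k < n) (-1) ^+ k.+1 * 'X^((a + b) * 'C(k.+1, 2) + a * k.+1).
  by rewrite -big_split; apply: eq_bigr => k _; rewrite /= exprS; ring.
apply: eqXD.
  rewrite big_ord_recr mulrDl -[X in eqX _ _ X]addr0 /=; apply: eqXD.
    rewrite mulr_suml.
    apply: (@eqX_sum _ _ _ (fun k => 'X^((a + b) * 'C(k, 2) + b * k)
        * ((-1) ^+ k * qbin 'X^(a + b) (2 * n) (n - k)) * poch R (a + b) (a + b) n)
      (fun k => (-1) ^+ k * 'X^((a + b) * 'C(k, 2) + b * k))) => k ltkn.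
    rewrite -[_ * poch _ _ _ _]mulrA mulrC -!mulrA; apply: eqXMl.
    rewrite -[X in eqX _ _ X]mul1r mulrA.
    apply: (@eqXMXn _ (n - k).+1); first by nia.
    by have [] := @qbin_limit R (a + b) n (n - k) c0 (leq_subr _ _).
  (* The first sum has one term more than [theta]; its degree is at least [n]. *)
  rewrite -mulrA -[X in eqX _ _ X](mul0r (((-1) ^+ n
    * qbin 'X^(a + b) (2 * n) (n - n)) * poch R (a + b) (a + b) n)).
  by apply/eqXMr/eqX_Xn; nia.
rewrite mulr_suml.
apply: (@eqX_sum _ _ _ (fun k => (-1) ^+ k.+1 * qbin 'X^(a + b) (2 * n) (n + k.+1)
      * 'X^((a + b) * 'C(k.+1, 2) + a * k.+1) * poch R (a + b) (a + b) n)
  (fun k => (-1) ^+ k.+1 * 'X^((a + b) * 'C(k.+1, 2) + a * k.+1))) => k ltkn.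
rewrite -!mulrA; apply: eqXMl; rewrite [X in eqX _ (_ * X)]mulrC.
rewrite -[X in eqX _ _ X]mul1r mulrA.
apply: (@eqXMXn _ (n - k.+1).+1); first by nia.
have [] := @qbin_limit R (a + b) n (n - k.+1) c0 (leq_subr _ _).
by have -> : (2 * n - (n - k.+1) = n + k.+1)%N by lia.
Qed.

Lemma jacobi_le (R : comNzRingType) a b N m n :
    (0 < a)%N -> (0 < b)%N -> (N <= m)%N -> (N <= n)%N ->
  eqX N (jprod R a b m) (theta R a b n).
Proof.
move=> a0 b0 leNm leNn.
apply: (eqX_trans (eqX_le leNm (@jacobi R a b m a0 b0))).
apply: (eqX_trans (theta_stable R a0 b0 leNm)).
exact: eqX_sym (theta_stable R a0 b0 leNn).
Qed.

(** * Dissections and the product formula for the generating function *)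

Lemma big_ord_mul (A : Type) (idx : A) (op : Monoid.law idx) k n (F : nat -> A) :
  \big[op/idx]_(i < k * n) F i = \big[op/idx]_(i < n) \big[op/idx]_(r < k) F (k * i + r)%N.
Proof.
elim: n => [|n IHn]; first by rewrite muln0 !big_ord0.
by rewrite mulnS addnC big_split_ord big_ord_recr /= IHn.
Qed.

Lemma poch_mul (R : comNzRingType) a c k n :
  poch R a c (k * n) = \prod_(r < k) poch R (a + c * r) (c * k) n.
Proof.
rewrite /poch (big_ord_mul _ _ _ (fun m => 1 - 'X^(a + c * m))) exchange_big /=.
apply: eq_bigr => r _; apply: eq_bigr => i _; congr (1 - 'X^_); ring.
Qed.

(** As [u] is a series in ['X^M], multiplication by it does not mix residue classes of exponents
    modulo [M]; its constant term 1 lets the coefficients of [D] be recovered by induction. *)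
Lemma coef_cancel (R : comNzRingType) M N r (D u : {poly R}) :
    u`_0 = 1 -> (forall i, ~~ (M %| i)%N -> u`_i = 0) ->
    (forall i, (i < N)%N -> i = r %[mod M] -> (D * u)`_i = 0) ->
  forall i, (i < N)%N -> i = r %[mod M] -> D`_i = 0.
Proof.
move=> u0 uM Du; elim/ltn_ind => i IHi ltiN eqir.
have := Du i ltiN eqir; rewrite coefM big_ord_recr /= subnn u0 mulr1.
rewrite big1 ?add0r // => -[j ltji] _ /=.
have [/dvdnP[q eq_ij]|/uM->] := boolP (M %| i - j)%N; last by rewrite mulr0.
have eqjr : j = r %[mod M].
  by rewrite -eqir -[in RHS](subnK (ltnW ltji)) eq_ij modnMDl.
by rewrite IHi ?mul0r // (ltn_trans ltji).
Qed.

Definition RD49_gf (R : comNzRingType) (n : nat) : {poly R} :=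
  \prod_(m < n | ~~ (4 %| m.+1)%N) \sum_(j < 9) 'X^(m.+1 * j).

(** Each inner sum is geometric, with value $(1-q^{9d})/(1-q^d)$; the parts up to [4 * n] prime to 4
    or twice an odd number fill three classes modulo 4. *)
Lemma RD49_gf_poch (R : comNzRingType) n :
  RD49_gf R (4 * n) * (poch R 1 4 n * poch R 2 4 n * poch R 3 4 n) =
  poch R 9 36 n * poch R 18 36 n * poch R 27 36 n.
Proof.
pose g d : {poly R} := \sum_(j < 9) 'X^(d * j).
have geo d : g d * (1 - 'X^d) = 1 - 'X^(9 * d).
  rewrite [RHS](_ : _ = 1 ^+ 9 - 'X^d ^+ 9); last by rewrite expr1n -exprM mulnC.
  rewrite subrXX mulrC; congr (_ * _); apply: eq_bigr => j _.
  by rewrite expr1n mul1r exprM.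
rewrite /RD49_gf (eq_bigr (fun m : 'I_(4 * n) => g m.+1)) // big_mkcond /=.
rewrite (big_ord_mul _ _ _ (fun m => if ~~ (4 %| m.+1)%N then g m.+1 else 1)).
rewrite -!big_split /=; apply: eq_bigr => i _.
have eq_r r : ((4 * i + r).+1 = r.+1 + 4 * i)%N by lia.
have dvd_r r : (4 %| r + 4 * i)%N = (4 %| r)%N by rewrite dvdn_addl ?dvdn_mulr.
rewrite !big_ord_recr !big_ord0 !eq_r !dvd_r /= mul1r mulr1.
transitivity (g (1 + 4 * i)%N * (1 - 'X^(1 + 4 * i))
  * (g (2 + 4 * i)%N * (1 - 'X^(2 + 4 * i)))
  * (g (3 + 4 * i)%N * (1 - 'X^(3 + 4 * i)))); first ring.
by rewrite !geo; congr ((1 - 'X^_) * (1 - 'X^_) * (1 - 'X^_)); lia.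
Qed.

(** The lengths [4 * n], [2 * n], [n] are matched: dissected modulo 4 and 36, all products have [n]
    factors, so the identity is exact and not only modulo a power of ['X]. *)
Lemma RD49_gf_jprod (R : comNzRingType) n :
  RD49_gf R (4 * n) * jprod R 1 1 (2 * n) * jprod R 9 27 n =
  jprod R 1 3 n * jprod R 9 9 (2 * n).
Proof.
rewrite /jprod !poch_mul !big_ord_recr !big_ord0 /= !mul1r !muln0 !muln1 !addn0.
rewrite -[(1 + 1)%N]/(2%N) -[(2 * 2)%N]/(4%N) -[(1 + 2)%N]/(3%N) -[(2 + 2)%N]/(4%N).
rewrite -[(1 + 3)%N]/(4%N) -[(9 + 27)%N]/(36%N) -[(9 + 9)%N]/(18%N).
rewrite -[(18 * 2)%N]/(36%N) -[(9 + 18)%N]/(27%N) -[(18 + 18)%N]/(36%N).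
transitivity (RD49_gf R (4 * n) * (poch R 1 4 n * poch R 2 4 n * poch R 3 4 n)
  * (poch R 1 4 n * poch R 3 4 n * poch R 4 4 n
     * (poch R 9 36 n * poch R 27 36 n * poch R 36 36 n))); first by ring.
by rewrite RD49_gf_poch; ring.
Qed.

(** * Product identities modulo 2 *)

(* Congruence modulo 2 and ['X^N], in the form needed when [4 = 0] in [R]. *)
Definition parX (R : comNzRingType) (N : nat) (p r : {poly R}) : Prop :=
  eqX N (2 * p) (2 * r).

Lemma parXM (R : comNzRingType) N (p p' r r' : {poly R}) :
  parX N p p' -> parX N r r' -> parX N (p * r) (p' * r').
Proof.
move=> pp rr; apply: (@eqX_trans _ _ (p * (2 * r'))).
  by rewrite mulrCA; apply: eqXMl.
by rewrite mulrCA !mulrA; apply: eqXMr.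
Qed.

Lemma parX_eqX (R : comNzRingType) N (p r : {poly R}) : eqX N p r -> parX N p r.
Proof. exact: eqXMl. Qed.

Lemma parX_trans (R : comNzRingType) N (r p s : {poly R}) :
  parX N p r -> parX N r s -> parX N p s.
Proof. exact: eqX_trans. Qed.

Lemma double_sign (A : comNzRingType) (four0 : 4 = 0 :> A) k :
  2 * (-1) ^+ k = 2 :> A.
Proof.
rewrite -signr_odd; case: odd; last by rewrite mulr1.
rewrite expr1; have -> : 2 * -1 = 2 - 4 :> A by ring.
by rewrite four0 subr0.
Qed.

(* As [(1 - x)^2 = 1 - x^2] modulo 2. *)
Lemma poch_double (R : comNzRingType) (four0 : 4 = 0 :> {poly R}) a c N :
    (0 < c)%N ->
  parX N ((poch R a (c * 2) N * poch R (a + c) (c * 2) N) ^+ 2)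
         (poch R (a * 2) (c * 2) N).
Proof.
move=> c0; have := poch_mul R a c 2 N.
rewrite !big_ord_recr big_ord0 /= mul1r muln0 addn0 muln1 => <-.
rewrite /parX; suff -> : 2 * poch R a c (2 * N) ^+ 2 = 2 * poch R (a * 2) (c * 2) (2 * N).
  by apply/parX_eqX/poch_stable; [nia | rewrite leq_pmull].
rewrite -prodrXl; apply: (big_rec2 (fun p q : {poly R} => 2 * p = 2 * q)) => // i p q _ eq_pq.
have -> : 'X^(a * 2 + c * 2 * i) = 'X^(a + c * i) ^+ 2 :> {poly R}.
  by rewrite -exprM; congr ('X^_); lia.
set x := 'X^_; transitivity ((1 - x) ^+ 2 * (2 * p)); first ring.
rewrite eq_pq.
transitivity (2 * ((1 - x ^+ 2) * q) - 4 * (x * (1 - x) * q)); first ring.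
by rewrite four0 mul0r subr0.
Qed.

Lemma eqX_cancel (R : comNzRingType) N (u p r : {poly R}) :
  u`_0 = 1 -> eqX N (p * u) (r * u) -> eqX N p r.
Proof.
move=> u0 pu i ltiN; apply/eqP; rewrite -subr_eq0 -coefB; apply/eqP.
apply: (@coef_cancel _ 1 N 0 _ u) => //; last by rewrite !modn1.
  by move=> j; rewrite dvd1n.
by move=> j ltjN _; rewrite mulrBl coefB pu // subrr.
Qed.

(** The product form of T B = q psi(q^9) modulo 2, the factor q removed. All products are dissected
    into the classes 3r modulo 36. *)
Lemma jprod_parity (R : comNzRingType) (four0 : 4 = 0 :> {poly R}) N :
  parX N (jprod R 3 15 (2 * N) * jprod R 3 6 (4 * N)) (jprod R 9 27 N).
Proof.
pose a r := poch R (3 * r) 36 N.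
have -> : jprod R 3 15 (2 * N) * jprod R 3 6 (4 * N)
  = (a 1 * a 7) ^+ 2 * (a 5 * a 11) ^+ 2 * (a 6 * a 12) ^+ 2
    * (a 4 * a 10 * a 2 * a 8 * a 3 * a 9).
  rewrite /jprod !poch_mul !big_ord_recr !big_ord0 /= !mul1r !muln0 !addn0.
  rewrite /a; ring.
have -> : jprod R 9 27 N = a 3 * a 9 * a 12 by [].
have d1 : parX N ((a 1 * a 7) ^+ 2) (a 2) by apply: (@poch_double R four0 3 18).
have d5 : parX N ((a 5 * a 11) ^+ 2) (a 10) by apply: (@poch_double R four0 15 18).
have d6 : parX N ((a 6 * a 12) ^+ 2) (a 12) by apply: (@poch_double R four0 18 18).
have d2 : parX N ((a 2 * a 8) ^+ 2) (a 4) by apply: (@poch_double R four0 6 18).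
have d4 : parX N ((a 4 * a 10) ^+ 2) (a 8) by apply: (@poch_double R four0 12 18).
set P := (_ * _ * _ * (_ * a 9)).
(* The factor [a 4 * a 8] completes the squares of [a 2 * a 8] and [a 4 * a 10], which reduce to
   [a 4] and [a 8]; it is cancelled afterwards. *)
have : parX N (P * (a 4 * a 8)) (a 3 * a 9 * a 12 * (a 4 * a 8)).
  apply: (@parX_trans _ _ ((a 2 * a 8) ^+ 2 * (a 4 * a 10) ^+ 2 * (a 3 * a 9 * a 12))).
    rewrite /P.
    have -> : (a 2 * a 8) ^+ 2 * (a 4 * a 10) ^+ 2 * (a 3 * a 9 * a 12)
       = a 2 * a 10 * a 12 * (a 4 * a 10 * a 2 * a 8 * a 3 * a 9) * (a 4 * a 8) by ring.
    do 2![apply: parXM => //]; do 2![apply: parXM => //].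
  by rewrite [X in parX _ _ X]mulrC; do 2![apply: parXM => //].
move=> PR; apply: (@eqX_cancel _ _ (a 4 * a 8)); last first.
  by rewrite -[2 * P * _]mulrA -[2 * (a 3 * a 9 * a 12) * _]mulrA.
by rewrite coef0M !(@poch_ge R 1) // coef1 mulr1.
Qed.

(** * Theta series modulo 4 and their 3-dissections *)

(** The squares strictly between 0 and [n * n] occur twice, with a sign that [four0] erases; [n * n]
    occurs only once, which the last term corrects. *)
Lemma theta_diag (R : comNzRingType) (four0 : 4 = 0 :> {poly R}) d n :
  theta R d d n =
  1 + 2 * \sum_(k < n) 'X^(d * (k.+1 * k.+1)) - (-1) ^+ n * 'X^(d * (n * n)).
Proof.
rewrite /theta; elim: n => [|n IHn].
  by rewrite !big_ord0 !muln0 !expr0; ring.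
rewrite !big_ord_recr IHn /= exprS.
have -> : ((d + d) * 'C(n, 2) + d * n = d * (n * n))%N.
  by rewrite -double_binomial2; lia.
have -> : ((d + d) * 'C(n.+1, 2) + d * n.+1 = d * (n.+1 * n.+1))%N.
  by rewrite -double_binomial2; lia.
set x := 'X^(d * (n.+1 * n.+1)); set y := 'X^_; set s := (-1) ^+ n.
set S := \sum_(i < n) _.
have sE : 2 * s = 2 :> {poly R} by rewrite double_sign.
apply/eqP; rewrite -subr_eq0; apply/eqP.
transitivity (- (2 * s) * x - 2 * x); first ring.
by rewrite sE; transitivity (- (4 * x)); [ring | rewrite four0 mul0r oppr0].
Qed.

(** The series B of the introduction, truncated. *)
Definition theta_1_3_mod3 (R : comNzRingType) (n : nat) : {poly R} :=
  \sum_(i < n) (-1) ^+ i *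
    ('X^(18 * (i * i) + 3 * i) - 'X^(18 * (i * i) + 15 * i + 3)
     + 'X^(18 * (i * i) + 21 * i + 6) - 'X^(18 * (i * i) + 33 * i + 15)).

Lemma theta_1_3 (R : comNzRingType) n :
  theta R 1 3 (3 * n) =
  \sum_(i < n) (-1) ^+ i *
    ('X^(18 * (i * i) + 3 * i) - 'X^(18 * (i * i) + 9 * i + 1)
     - 'X^(18 * (i * i) + 15 * i + 3) + 'X^(18 * (i * i) + 21 * i + 6)
     + 'X^(18 * (i * i) + 27 * i + 10) - 'X^(18 * (i * i) + 33 * i + 15)).
Proof.
rewrite /theta (big_ord_mul _ _ _ (fun k => (-1) ^+ k
  * ('X^((1 + 3) * 'C(k, 2) + 3 * k) - 'X^((1 + 3) * 'C(k.+1, 2) + 1 * k.+1)))).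
apply: eq_bigr => i _; rewrite !big_ord_recr big_ord0 /= add0r.
have sgn r : (-1) ^+ (3 * i + r) = (-1) ^+ i * (-1) ^+ r :> {poly R}.
  by rewrite exprD exprM -signr_odd.
rewrite !sgn.
have u k : ((1 + 3) * 'C(k, 2) + 3 * k = 2 * (k * k) + k)%N.
  by rewrite -double_binomial2; lia.
have v k : ((1 + 3) * 'C(k.+1, 2) + 1 * k.+1 = 2 * (k * k) + 3 * k + 1)%N.
  by rewrite -double_binomial2 binS bin1; lia.
rewrite !u !v !addn0.
have -> : (2 * (3 * i * (3 * i)) + 3 * i = 18 * (i * i) + 3 * i)%N by lia.
have -> : (2 * (3 * i * (3 * i)) + 3 * (3 * i) + 1 = 18 * (i * i) + 9 * i + 1)%N by lia.
have -> : (2 * ((3 * i + 1) * (3 * i + 1)) + (3 * i + 1)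
           = 18 * (i * i) + 15 * i + 3)%N by lia.
have -> : (2 * ((3 * i + 1) * (3 * i + 1)) + 3 * (3 * i + 1) + 1
           = 18 * (i * i) + 21 * i + 6)%N by lia.
have -> : (2 * ((3 * i + 2) * (3 * i + 2)) + (3 * i + 2)
           = 18 * (i * i) + 27 * i + 10)%N by lia.
have -> : (2 * ((3 * i + 2) * (3 * i + 2)) + 3 * (3 * i + 2) + 1
           = 18 * (i * i) + 33 * i + 15)%N by lia.
by move: ('X^_) ('X^_) ('X^_) ('X^_) ('X^_) ('X^_) => *; ring.
Qed.

(** The exponents of psi(q) are the triangular numbers. They are 0 or 1 modulo 3, and those that are
    1 have the form 9t + 1 with t triangular. *)
Lemma theta_1_3_split (R : comNzRingType) n :
  theta R 1 3 (3 * n) = theta_1_3_mod3 R n - 'X * theta R 9 27 n.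
Proof.
rewrite theta_1_3 /theta_1_3_mod3 /theta mulr_sumr -sumrB; apply: eq_bigr => i _.
have -> : ((9 + 27) * 'C(i, 2) + 27 * i = 18 * (i * i) + 9 * i)%N.
  by rewrite -double_binomial2; lia.
have -> : ((9 + 27) * 'C(i.+1, 2) + 9 * i.+1 = 18 * (i * i) + 27 * i + 9)%N.
  by rewrite -double_binomial2 binS bin1; lia.
have -> : (18 * (i * i) + 9 * i + 1 = (18 * (i * i) + 9 * i).+1)%N by lia.
have -> : (18 * (i * i) + 27 * i + 10 = (18 * (i * i) + 27 * i + 9).+1)%N by lia.
by rewrite !(exprS 'X); move: ('X^_) ('X^_) ('X^_) ('X^_) ('X^_) ('X^_) => *; ring.
Qed.

(** The series T of the introduction, truncated. *)
Definition nonmult3_squares (R : comNzRingType) (n : nat) : {poly R} :=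
  \sum_(k < n) ('X^((3 * k + 1) * (3 * k + 1)) + 'X^((3 * k + 2) * (3 * k + 2))).

Lemma squares_split (R : comNzRingType) n :
  \sum_(k < 3 * n) 'X^(1 * (k.+1 * k.+1)) =
  nonmult3_squares R n + \sum_(k < n) 'X^(9 * (k.+1 * k.+1)).
Proof.
rewrite (big_ord_mul _ _ _ (fun k => 'X^(1 * (k.+1 * k.+1)))) -big_split /=.
apply: eq_bigr => i _; rewrite !big_ord_recr big_ord0 /= add0r.
by congr ('X^_ + 'X^_ + 'X^_); lia.
Qed.

Lemma double_signM (R : comNzRingType) (four0 : 4 = 0 :> {poly R}) k (p : {poly R}) :
  2 * ((-1) ^+ k * p) = 2 * p.
Proof. by rewrite mulrA double_sign. Qed.

(** Signs being irrelevant modulo 2, T becomes a theta series, to which the triple product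
    applies. *)
Lemma nonmult3_squares_parity (R : comNzRingType) (four0 : 4 = 0 :> {poly R}) n :
  2 * nonmult3_squares R n = 2 * ('X * theta R 3 15 n).
Proof.
rewrite /theta mulrCA !mulr_sumr; apply: eq_bigr => i _.
rewrite double_signM //.
have -> : ((3 + 15) * 'C(i, 2) + 15 * i = 9 * (i * i) + 6 * i)%N.
  by rewrite -double_binomial2; lia.
have -> : ((3 + 15) * 'C(i.+1, 2) + 3 * i.+1 = 9 * (i * i) + 12 * i + 3)%N.
  by rewrite -double_binomial2 binS bin1; lia.
have -> : ((3 * i + 1) * (3 * i + 1) = (9 * (i * i) + 6 * i).+1)%N by lia.
have -> : ((3 * i + 2) * (3 * i + 2) = (9 * (i * i) + 12 * i + 3).+1)%N by lia.
rewrite !exprS; set x := 'X^_; set y := 'X^_.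
transitivity ('X * (2 * (x - y)) + 4 * ('X * y)); first ring.
by rewrite four0 mul0r addr0.
Qed.

(** The four terms of B of index [i] are those of indices [2 * i] and [2 * i + 1] in the pentagonal
    series of $f_3$, up to sign. *)
Lemma theta_1_3_mod3_parity (R : comNzRingType) (four0 : 4 = 0 :> {poly R}) n :
  2 * theta_1_3_mod3 R n = 2 * theta R 3 6 (2 * n).
Proof.
rewrite /theta (big_ord_mul _ _ _ (fun k => (-1) ^+ k
  * ('X^((3 + 6) * 'C(k, 2) + 6 * k) - 'X^((3 + 6) * 'C(k.+1, 2) + 3 * k.+1)))).
rewrite !mulr_sumr; apply: eq_bigr => i _.
rewrite !big_ord_recr big_ord0 /= add0r [in RHS]mulrDr !(double_signM four0) !addn0.
have := double_binomial2 (2 * i); have := double_binomial2 (2 * i + 1).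
have := double_binomial2 (2 * i).+1; have := double_binomial2 (2 * i + 1).+1.
move=> b4 b3 b2 b1.
have -> : ((3 + 6) * 'C(2 * i, 2) + 6 * (2 * i) = 18 * (i * i) + 3 * i)%N by lia.
have -> : ((3 + 6) * 'C((2 * i).+1, 2) + 3 * (2 * i).+1
           = 18 * (i * i) + 15 * i + 3)%N by lia.
have -> : ((3 + 6) * 'C(2 * i + 1, 2) + 6 * (2 * i + 1)
           = 18 * (i * i) + 21 * i + 6)%N by lia.
have -> : ((3 + 6) * 'C((2 * i + 1).+1, 2) + 3 * (2 * i + 1).+1
           = 18 * (i * i) + 33 * i + 15)%N by lia.
by move: ('X^_) ('X^_) ('X^_) ('X^_) => *; ring.
Qed.

Lemma coef_theta_1_3_mod3 (R : comNzRingType) n i :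
  ~~ (3 %| i)%N -> (theta_1_3_mod3 R n)`_i = 0.
Proof.
move=> i3; rewrite coef_sum big1 // => k _.
rewrite -signr_odd mulr_sign; case: odd; rewrite ?coefN !coefB coefD coefB !coefXn;
  do 4 (case: eqVneq => [|_]; first by lia); by rewrite !subr0 ?addr0 ?oppr0.
Qed.

Lemma coef_theta_9_27 (R : comNzRingType) n i :
  ~~ (3 %| i)%N -> (theta R 9 27 n)`_i = 0.
Proof.
move=> i3; rewrite coef_sum big1 // => k _.
rewrite -signr_odd mulr_sign; case: odd; rewrite ?coefN !coefB !coefXn;
  do 2 (case: eqVneq => [|_]; first by lia); by rewrite !subr0 ?oppr0.
Qed.

Lemma coef_nonmult3_squares (R : comNzRingType) n i :
  (forall k, i != (k * k)%N) \/ i != 1 %[mod 3] -> (nonmult3_squares R n)`_i = 0.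
Proof.
move=> i_ns; rewrite coef_sum big1 // => k _; rewrite coefD !coefXn.
have nesq j : j != 0 %[mod 3] -> (i == j * j)%N = false.
  move=> j3; apply/negP=> /eqP ij; case: i_ns => [/(_ j)|]; first by rewrite ij eqxx.
  rewrite ij -modnMm; move: j3; have : (j %% 3 < 3)%N by rewrite ltn_mod.
  by case: (j %% 3)%N => [|[|[]]].
by rewrite !nesq ?addr0 // mulnC modnMDl.
Qed.

(** * The generating function modulo 4 *)

Lemma RD49_gf_mod4 (R : comNzRingType) (four0 : 4 = 0 :> {poly R}) K :
  eqX K ((RD49_gf R (4 * K) - 'X + 2 * ('X * nonmult3_squares R K)) * theta R 9 27 K)
        (theta_1_3_mod3 R K).
Proof.
set G := RD49_gf _ _; set T := nonmult3_squares _ _; set B := theta_1_3_mod3 _ _.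
set P9 := theta _ _ _ _.
pose S9 : {poly R} := \sum_(k < K) 'X^(9 * (k.+1 * k.+1)).
have phi : eqX K (jprod R 1 1 (2 * K)) (1 + 2 * (T + S9)).
  apply: (@eqX_trans _ _ (theta R 1 1 (3 * K))).
    by apply: jacobi_le; rewrite ?leq_pmull.
  rewrite theta_diag // squares_split -/T -/S9 -[X in eqX _ _ X]subr0.
  apply: eqXB => //; rewrite -[X in eqX _ _ X](mulr0 ((-1) ^+ (3 * K))).
  by apply/eqXMl/eqX_Xn; nia.
have phi9 : eqX K (jprod R 9 9 (2 * K)) (1 + 2 * S9).
  apply: (@eqX_trans _ _ (theta R 9 9 K)).
    by apply: jacobi_le; rewrite ?leq_pmull.
  rewrite theta_diag // -/S9 -[X in eqX _ _ X]subr0.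
  apply: eqXB => //; rewrite -[X in eqX _ _ X](mulr0 ((-1) ^+ K)).
  by apply/eqXMl/eqX_Xn; nia.
have psi : eqX K (jprod R 1 3 K) (B - 'X * P9).
  by rewrite -theta_1_3_split; apply: jacobi_le; rewrite ?leq_pmull.
have psi9 : eqX K (jprod R 9 27 K) P9 by apply: jacobi_le.
have main : eqX K (G * P9) ((B - 'X * P9) * (1 + 2 * T)).
  (* As phi(q)^2 = 1, both sides can be given a common factor phi(q); what remains is
     [RD49_gf_jprod]. *)
  have -> : G * P9 = G * (1 + 2 * (T + S9)) * P9 * (1 + 2 * (T + S9)).
    apply/eqP; rewrite -subr_eq0; apply/eqP.
    transitivity (- (4 * (G * P9 * (T + S9) * (1 + T + S9)))); first ring.
    by rewrite four0 mul0r oppr0.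
  have -> : (B - 'X * P9) * (1 + 2 * T) =
      (B - 'X * P9) * (1 + 2 * S9) * (1 + 2 * (T + S9)).
    apply/eqP; rewrite -subr_eq0; apply/eqP.
    transitivity (- (4 * ((B - 'X * P9) * S9 * (1 + S9 + T)))); first ring.
    by rewrite four0 mul0r oppr0.
  apply: eqXMr.
  apply: (@eqX_trans _ _ (jprod R 1 3 K * jprod R 9 9 (2 * K))); last exact: eqXM.
  rewrite -RD49_gf_jprod; apply: eqX_sym.
  by apply: eqXM => //; apply: eqXM.
(* Modulo 2 both T and B are theta series, hence products, and [jprod_parity] evaluates their
   product. *)
have parity : eqX K (2 * (T * B)) ('X * (2 * P9)).
  have -> : 2 * (T * B) = 'X * (2 * (theta R 3 15 K * theta R 3 6 (2 * K))).
    rewrite mulrA nonmult3_squares_parity // -mulrA mulrCA theta_1_3_mod3_parity //.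
    ring.
  apply: eqXMl; apply: (@parX_trans _ _ (jprod R 3 15 (2 * K) * jprod R 3 6 (4 * K))).
    by apply/parX_eqX/eqX_sym/eqXM; apply: jacobi_le; rewrite ?leq_pmull.
  exact: parX_trans (@jprod_parity R four0 K) (parX_eqX psi9).
have -> : (G - 'X + 2 * ('X * T)) * P9 =
   G * P9 - ('X * P9 - 2 * ('X * T) * P9) by ring.
have -> : B = B + 'X * (2 * P9) - 'X * P9 - 2 * ('X * T) * P9
            - ('X * P9 - 2 * ('X * T) * P9) by ring.
apply: eqXB => //; apply: (eqX_trans main).
have -> : (B - 'X * P9) * (1 + 2 * T)
  = B + 2 * (T * B) - 'X * P9 - 2 * ('X * T) * P9 by ring.
by do 2![apply: eqXB => //]; apply: eqXD.
Qed.

(** By [coef_cancel] with modulus 3, G agrees with q - 2 q T at the exponents prime to 3. *)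
Lemma coef_RD49_gf (R : comNzRingType) (four0 : 4 = 0 :> {poly R}) K i :
    (i < K)%N -> i != 0 %[mod 3] ->
    i = 1 %[mod 3] /\ i != 1%N \/ i = 2 %[mod 3] /\ (forall k, i != (k * k).+1) ->
  (RD49_gf R (4 * K))`_i = 0.
Proof.
move=> ltiK i0 i_ok.
pose D := RD49_gf R (4 * K) - 'X + 2 * ('X * nonmult3_squares R K).
have Di : D`_i = 0.
  apply: (@coef_cancel _ 3 K i D (theta R 9 27 K)) => //; last 1 first.
  - move=> j ltjK eqij; rewrite (RD49_gf_mod4 four0 ltjK) coef_theta_1_3_mod3 //.
    by rewrite /dvdn eqij.
  - rewrite (@theta_stable R 9 27 1 K) ?(leq_ltn_trans _ ltiK) //.
    by rewrite /theta big_ord1 mul1r coefB !coefXn subr0.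
  - exact: coef_theta_9_27.
have -> : RD49_gf R (4 * K) = D + 'X - 2 * ('X * nonmult3_squares R K) by rewrite /D; ring.
rewrite coefB coefD Di add0r coefX mulr_natl coefMn coefXM.
case: i ltiK i0 i_ok {Di} => // i ltiK i0 i_ok /=.
rewrite coef_nonmult3_squares ?mul0rn ?subr0.
  by case: i_ok => [[_ /negbTE->]|[+ _]] //; case: i {ltiK i0}.
(* The exponents of T are squares that are 1 modulo 3: the first case violates the residue, the
   second the squareness. *)
case: i_ok => [[i1 _]|[i2 ns]]; [right | left => k].
  by rewrite -(eqn_modDr 1) addn1 i1.
by have := ns k; rewrite eqSS.
Qed.

(** * Partitions as multiplicity functions *)

Lemma coef_RD49_gf_card (R : comNzRingType) L n :
  (RD49_gf R L)`_n =
  #|[set f : {ffun 'I_L -> 'I_9} |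
      [forall m : 'I_L, (4 %| m.+1)%N ==> (f m == 0 :> nat)] &&
      (\sum_(m < L) m.+1 * f m == n)%N]|%:R.
Proof.
(* For a part divisible by 4 only the multiplicity 0 is kept, with term 1, so that the product runs
   over all parts. *)
pose F (m : 'I_L) (j : 'I_9) : {poly R} :=
  if (4 %| m.+1)%N ==> (j == 0 :> nat) then 'X^(m.+1 * j) else 0.
have -> : RD49_gf R L = \prod_(m < L) \sum_(j < 9) F m j.
  rewrite /RD49_gf big_mkcond /=; apply: eq_bigr => m _; rewrite /F.
  case: (4 %| m.+1)%N => /=; last by [].
  by rewrite big_ord_recl muln0 big1 ?addr0.
rewrite bigA_distr_bigA coef_sum -sum1_card natr_sum [RHS]big_mkcond /=.
apply: eq_bigr => f _; rewrite inE.
case: (boolP [forall m : 'I_L, (4 %| m.+1)%N ==> (f m == 0 :> nat)])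
  => [/forallP f_ok|/forallPn[m f_m]] /=; last first.
  by rewrite (bigD1 m) //= /F (negbTE f_m) mul0r coef0.
rewrite (eq_bigr (fun m : 'I_L => 'X^(m.+1 * f m))) => [|m _]; last by rewrite /F f_ok.
by rewrite -expr_sum coefXn eq_sym; case: eqP.
Qed.

Lemma sumn_count L s : all (fun k => 0 < k <= L)%N s ->
  (\sum_(m < L) m.+1 * count_mem m.+1 s = sumn s)%N.
Proof.
elim: s => [|k s IHs] /=; first by rewrite big1 // => m _; rewrite muln0.
case/andP=> /andP[k0 leKL] /IHs <-.
have ltkL : (k.-1 < L)%N by rewrite prednK.
under eq_bigr => m _ do rewrite mulnDr.
rewrite big_split /=; congr (_ + _)%N.
rewrite (bigD1 (Ordinal ltkL)) //= prednK // eqxx muln1 big1 ?addn0 // => m neq_m.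
rewrite (_ : (k == m.+1) = false) ?muln0 //; apply/negP=> /eqP km.
by case/eqP: neq_m; apply: val_inj; rewrite /= km.
Qed.

Lemma is_partition_range n L s : (n <= L)%N -> is_partition n s ->
  all (fun k => 0 < k <= L)%N s.
Proof.
move=> lenL /and3P[_ s_gt0 /eqP sum_s]; apply/allP=> k s_k.
rewrite (allP s_gt0) //=; apply: leq_trans lenL; rewrite -sum_s.
by rewrite sumnE (big_rem k) //= leq_addr.
Qed.

Lemma sorted_geq_count s t : sorted geq s -> sorted geq t ->
  (forall k, count_mem k s = count_mem k t) -> s = t.
Proof.
move=> s_sorted t_sorted eq_count; apply: (sorted_eq _ _ s_sorted t_sorted).
- by move=> a b c /= ba ac; apply: leq_trans ba.
- by move=> a b; rewrite /= andbC -eqn_leq => /eqP.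
- by rewrite /perm_eq; apply/allP=> k _ /=; rewrite eq_count.
Qed.

(** A partition corresponds to the function giving the multiplicity of each part [m.+1]; any bound
    [L >= n] on the parts will do. *)
Lemma RD_4_9_card L n : (n <= L)%N ->
  RD 4 9 n =
  #|[set f : {ffun 'I_L -> 'I_9} |
      [forall m : 'I_L, (4 %| m.+1)%N ==> (f m == 0 :> nat)] &&
      (\sum_(m < L) m.+1 * f m == n)%N]|.
Proof.
move=> lenL; rewrite /RD; set B := [set u | _]; set A := [set f | _].
pose part (u : n.-bseq 'I_n.+1) := [seq val k | k <- u].
have B_part u : u \in B -> [/\ is_partition n (part u), regular 4 (part u)
    & forall k, (count_mem k (part u) < 9)%N].
  rewrite inE => /and3P[part_u reg_u dist_u]; split=> // k.
  have [/(allP dist_u)//|] := boolP (k \in part u).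
  by rewrite -has_pred1 has_count -eqn0Ngt => /eqP->.
pose h (u : n.-bseq 'I_n.+1) : {ffun 'I_L -> 'I_9} :=
  [ffun m : 'I_L => inord (count_mem m.+1 (part u))].
have h_count u (m : 'I_L) : u \in B -> h u m = count_mem m.+1 (part u) :> nat.
  by case/B_part=> _ _ u9; rewrite ffunE inordK.
have h_inj : {in B &, injective h}.
  move=> u v Bu Bv eq_h; apply/val_inj/(inj_map val_inj).
  have [pu _ _] := B_part u Bu; have [pv _ _] := B_part v Bv.
  case/and3P: (pu) (pv) => su _ _ /and3P[sv _ _].
  apply: sorted_geq_count => // k.
  have [/andP[k0 kL]|k_out] := boolP (0 < k <= L)%N.
    have ltkL : (k.-1 < L)%N by rewrite prednK.
    have := congr1 (fun f : {ffun 'I_L -> 'I_9} => nat_of_ord (f (Ordinal ltkL))) eq_h.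
    by rewrite /= !h_count //= prednK.
  have out w : is_partition n w -> count_mem k w = 0%N.
    move=> pw; apply/count_memPn; apply: contra k_out.
    exact: (allP (is_partition_range lenL pw)).
  by rewrite !out.
rewrite -(card_in_imset h_inj); congr #|pred_of_set _|; apply/setP=> f.
apply/imsetP/idP=> [[u Bu ->]|].
  have [pu ru _] := B_part u Bu; rewrite inE; apply/andP; split.
    apply/forallP=> m; apply/implyP=> m4; rewrite h_count //.
    apply/eqP/count_memPn; apply: contraL m4 => /(allP ru); exact.
  under eq_bigr => m _ do rewrite h_count //.
  rewrite sumn_count; last exact: is_partition_range pu.
  by case/and3P: pu.
rewrite inE => /andP[/forallP f4 sum_f].
(* The preimage of [f]: each part [m.+1] repeated [f m] times, in decreasing order. *)
pose s := sort geq (flatten [seq nseq (f m) m.+1 | m <- enum 'I_L]).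
have s_count (m : 'I_L) : count_mem m.+1 s = f m.
  rewrite count_sort count_flatten -map_comp sumnE big_map big_enum /=.
  rewrite (bigD1 m) //= count_nseq /= eqxx mul1n big1 ?addn0 // => j neq_jm.
  by rewrite count_nseq /= eqSS -[_ == _]/(j == m) (negbTE neq_jm).
have s_mem k : k \in s -> exists m : 'I_L, k = m.+1.
  rewrite mem_sort => /flattenP[_ /mapP[m _ ->]].
  by rewrite mem_nseq => /andP[_ /eqP->]; exists m.
have s_range : all (fun k => 0 < k <= L)%N s.
  by apply/allP=> k /s_mem[m ->]; rewrite /= ltn_ord.
have s_part : is_partition n s.
  apply/and3P; split.
  - by apply: sort_sorted => a b; rewrite /= leq_total.
  - by apply/allP=> k /s_mem[m ->].
  - by rewrite -(sumn_count s_range); under eq_bigr => m _ do rewrite s_count.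
have [u [us _]] := is_partition_bseq s_part.
have Bu : u \in B.
  rewrite inE us; apply/and3P; split=> //; apply/allP=> k sk; last first.
    by have [m ->] := s_mem k sk; rewrite s_count.
  have [m km] := s_mem k sk; apply/negP=> k4; move: sk.
  rewrite -has_pred1 has_count km s_count.
  by have := f4 m; rewrite -km k4 /= => /eqP->.
by exists u => //; apply/ffunP=> m; apply: val_inj; rewrite /= h_count // /part us s_count.
Qed.

(** * Congruences for [RD] and the arithmetic of the argument *)

Lemma RD_4_9_mod4 n : n != 0 %[mod 3] ->
    n = 1 %[mod 3] /\ n != 1%N \/ n = 2 %[mod 3] /\ (forall k, n != (k * k).+1) ->
  RD 4 9 n = 0 %[mod 4].
Proof.
move=> n0 n_ok.
have four0 : 4 = 0 :> {poly 'Z_4} by rewrite -polyC_natr (_ : 4%:R = 0) //; apply/val_inj.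
have := coef_RD49_gf four0 (ltnSn n) n0 n_ok.
rewrite coef_RD49_gf_card -RD_4_9_card; last by lia.
by move/(congr1 val); rewrite /= val_Zp_nat.
Qed.

Lemma logn_square p k : odd (logn p (k * k)) = false.
Proof. by rewrite mulnn lognX mul2n odd_double. Qed.

Local Close Scope ring_scope.

Theorem theorem3p1 (p : nat) (p_prime : prime p) (p_mod4 : p = 3 %[mod 4])
    (alpha n i : nat) (i_range : 1 <= i <= p - 1) :
  RD 4 9 (12 * p ^ (2 * alpha + 1) * (p * n + i) + p ^ (2 * alpha + 2) + 1)
    = 0 %[mod 4].
Proof.
have [i0 ip] : 0 < i /\ i < p by have := prime_gt0 p_prime; lia.
have p_odd : p %% 2 = 1.
  by have := modn_dvdm p (isT : 2 %| 4); rewrite p_mod4.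
set q := p ^ (2 * alpha + 1).
have -> : p ^ (2 * alpha + 2) = q * p by rewrite -expnSr; congr (p ^ _); lia.
have -> : 12 * q * (p * n + i) + q * p + 1 = (q * (12 * (p * n + i) + p)).+1 by lia.
have [p3|p_neq3] := eqVneq p 3.
  have q3 : q = 3 * 9 ^ alpha by rewrite /q p3 addn1 expnS expnM.
  (* The form [r.+1] records positivity, so that the argument is not the exceptional index 1. *)
  have [r rE] : exists r, q * (12 * (p * n + i) + p) = 3 * r.+1.
    exists (9 ^ alpha * (12 * (p * n + i) + p)).-1.
    rewrite prednK ?q3 ?mulnA // muln_gt0 expn_gt0 /=; lia.
  apply: RD_4_9_mod4; rewrite rE -addn1 mulnC modnMDl //; left; split=> //; lia.
have p_ndvd : ~~ (p %| 12 * (p * n + i) + p).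
  rewrite dvdn_addl // Euclid_dvdM // (dvdn_addr _ (dvdn_mulr _ (dvdnn p))).
  rewrite (gtnNdvd i0 ip) orbF (Euclid_dvdM 4 3) // (Euclid_dvdM 2 2) //.
  rewrite !dvdn_prime2 // (negbTE p_neq3) orbF orbb; apply/eqP=> p2.
  by rewrite p2 in p_odd.
(* This odd valuation is what prevents the argument minus 1 from being a square. *)
have logq : logn p (q * (12 * (p * n + i) + p)) = 2 * alpha + 1.
  have q0 : 0 < q by rewrite expn_gt0 prime_gt0.
  rewrite lognM //; last by lia.
  by rewrite [logn p q]pfactorK // lognE (negbTE p_ndvd) !andbF addn0.
have p3 : p %% 3 != 0 by rewrite -/(dvdn 3 p) dvdn_prime2 // eq_sym.
have p_sq : p ^ 2 = 1 %[mod 3].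
  by rewrite -modnXm; move: p3 (ltn_pmod p (isT : 0 < 3)); case: (p %% 3) => [|[|[]]].
(* The term with 12 vanishes modulo 3, and [q * p] is a power of [p ^ 2], which is 1. *)
have mod3 : q * (12 * (p * n + i) + p) = 1 %[mod 3].
  rewrite mulnDr; have -> : q * p = (p ^ 2) ^ alpha.+1.
    by rewrite -expnSr -expnM; congr (p ^ _); lia.
  have -> : q * (12 * (p * n + i)) = q * (4 * (p * n + i)) * 3 by lia.
  by rewrite modnMDl -modnXm p_sq modnXm exp1n.
have mod3S : (q * (12 * (p * n + i) + p)).+1 = 2 %[mod 3].
  by rewrite -addn1 -modnDml mod3.
apply: RD_4_9_mod4; rewrite mod3S //; right; split=> // k; rewrite eqSS.
apply/eqP=> M_sq; have := logn_square p k.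
by rewrite -M_sq logq oddD oddM.
Qed.
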